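(* Let $n\ge 2$, $N\ge 1$, let $\Omega\subset\mathbb{R}^n$ be open and bounded, let $p\in(1,\infty)$, $\varepsilon\in[0,1]$ and $p'=\frac{p}{p-1}$. Let $a\in\mathcal{E}(\Omega)$, $F\in L^{p'}(\Omega;\mathbb{C}^{N\times n})$ and $g\in W^{1,p}(\Omega;\mathbb{C}^N)$ be given. Then there is at most one weak solution $u$ to $$-\operatorname{div}\big(a(x)(\varepsilon^2+|\nabla u|^2)^{\frac{p-2}{2}}\nabla u\big)=-\operatorname{div}F\quad\text{in }\Omega$$ satisfying $u\in g+W_0^{1,p}(\Omega;\mathbb{C}^N)$, i.e. $u-g\in W_0^{1,p}(\Omega;\mathbb{C}^N)$.
   Context: Inner product and norms: for $F=F^R+iF^I,\ G=G^R+iG^I\in\mathbb{C}^{N\times n}$ with rows $F_j,G_j$, set $\langle F,G\rangle=\sum_{j=1}^N\big(F_j^R\cdot G_j^R+F_j^I\cdot G_j^I+i(-F_j^R\cdot G_j^I+F_j^I\cdot G_j^R)\big)=\sum_j F_j\cdot\overline{G_j}$ and $|F|=\langle F,F\rangle^{1/2}$. Complex Sobolev functions are $u=u^R+iu^I$ with real and imaginary parts in the corresponding real Sobolev space, and $\nabla u=\nabla u^R+i\nabla u^I\in\mathbb{C}^{N\times n}$. Convention: for $\varepsilon=0$, expressions such as $(\varepsilon^2+|\xi|^2)^{\frac{p-2}{2}}\xi$ at $\xi=0$, and $(\varepsilon^2+|F|^2+|G|^2)^{\frac{p-2}{2}}|F-G|^k$ ($k=1,2$) at $F=G=0$, are read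 as $0$. Constants $c_1,c_2$: fixed positive constants depending only on $p$ such that for all $F,G\in\mathbb{C}^{N\times n}$ and $\varepsilon\in[0,1]$ $$c_1(\varepsilon^2+|F|^2+|G|^2)^{\frac{p-2}{2}}|F-G|^2\le\operatorname{Re}\big\langle(\varepsilon^2+|F|^2)^{\frac{p-2}{2}}F-(\varepsilon^2+|G|^2)^{\frac{p-2}{2}}G,\,F-G\big\rangle,$$ $$\big|(\varepsilon^2+|F|^2)^{\frac{p-2}{2}}F-(\varepsilon^2+|G|^2)^{\frac{p-2}{2}}G\big|\le c_2(\varepsilon^2+|F|^2+|G|^2)^{\frac{p-2}{2}}|F-G|.$$ Class $\mathcal{E}(\Omega)$ (with fixed constants $0<\nu<L$): all $a=a^R+ia^I:\Omega\to\mathbb{C}$ with $a^R,a^I:\Omega\to\mathbb{R}$ bounded and measurable such that for a.e. $x\in\Omega$: $\nu<a^R(x)-|a^I(x)|$, $a^R(x)+|a^I(x)|<L$, and $c_1a^R(x)-c_2|a^I(x)|>\nu$. Weak solution: $u\in W^{1,p}(\Omega;\mathbb{C}^N)$ is a weak solution to the equation if for every $\varphi\in W_0^{1,p}(\Omega;\mathbb{C}^N)$, $$\int_\Omega a(x)(\varepsilon^2+|\nabla u|^2)^{\frac{p-2}{2}}\langle\nabla u,\nabla\varphi\rangle\,dx=\int_\Omega\langle F,\nabla\varphi\rangle\,dx.$$ *)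

(* Defs.v *)
From HB Require Import structures.
From mathcomp Require Import all_boot all_order all_algebra.
From mathcomp Require Import complex.
From mathcomp Require Import all_classical all_reals all_analysis.

Set Implicit Arguments.
Unset Strict Implicit.
Unset Printing Implicit Defensive.

Import Order.TTheory GRing.Theory Num.Theory.
Import numFieldNormedType.Exports.

Local Open Scope classical_set_scope.
Local Open Scope ring_scope.

(* Lebesgue measure on R^n: the n-fold product of the one-dimensional Lebesgue
   measure, on the sigma-algebra generated by the coordinates (the Borel sets),
   and then its completion. *)

Definition rV_space (R : realType) (n : nat) : Type := 'rV[R]_n.

Definition rV_display : measure_display.
Proof. exact: default_measure_display. Qed.

Section rV_measurable.
Variables (R : realType) (n : nat).

Let coord (i : 'I_n) (x : rV_space R n) : R := (x : 'rV[R]_n) 0 i.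

Let rV_set0 : g_sigma_preimage coord set0.
Proof. exact: sigma_algebra0. Qed.

Let rV_setC A : g_sigma_preimage coord A -> g_sigma_preimage coord (~` A).
Proof. exact: sigma_algebraC. Qed.

Let rV_bigcup (F : _^nat) : (forall i, g_sigma_preimage coord (F i)) ->
  g_sigma_preimage coord (\bigcup_i (F i)).
Proof. exact: sigma_algebra_bigcup. Qed.

HB.instance Definition _ := Pointed.copy (rV_space R n) 'rV[R]_n.
HB.instance Definition _ := @isMeasurable.Build rV_display
  (rV_space R n) (g_sigma_preimage coord) rV_set0 rV_setC rV_bigcup.

Lemma measurable_rV_coord (i : 'I_n) :
  measurable_fun setT (fun x : rV_space R n => (x : 'rV[R]_n) 0 i).
Proof.
move=> _ Y mY; rewrite setTI; apply: sub_sigma_algebra => /=.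
rewrite -bigcup_seq/=; exists i => /=; first by rewrite mem_index_enum.
by exists Y => //; rewrite setTI.
Qed.

Lemma measurable_fun_rVP d (T : measurableType d) (f : T -> rV_space R n) :
  (forall i, measurable_fun setT (fun t => (f t : 'rV[R]_n) 0 i)) ->
  measurable_fun setT f.
Proof.
move=> mf _ A mA; rewrite setTI.
have : g_sigma_preimage (fun i => coord i \o f) (f @^-1` A).
  rewrite g_sigma_preimage_comp; exists A => //; by rewrite setTI.
apply: smallest_sub; first exact: sigma_algebra_measurable.
move=> B; rewrite -bigcup_seq => -[i _] [C mC <-].
exact: mf.
Qed.

End rV_measurable.

Definition rV_cons (R : realType) (n : nat) (z : R * rV_space R n) :
    rV_space R n.+1 :=
  \row_i (if unlift ord0 i is Some j then (z.2 : 'rV[R]_n) 0 j else z.1).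

Definition rV_uncons (R : realType) (n : nat) (x : rV_space R n.+1) :
    R * rV_space R n :=
  ((x : 'rV[R]_n.+1) 0 0, \row_j (x : 'rV[R]_n.+1) 0 (lift ord0 j)).

Lemma rV_consK (R : realType) (n : nat) :
  cancel (@rV_cons R n) (@rV_uncons R n).
Proof.
case=> x v; rewrite /rV_uncons /rV_cons !mxE unlift_none /=; congr pair.
by apply/rowP => j; rewrite !mxE liftK.
Qed.

Lemma measurable_rV_cons (R : realType) (n : nat) :
  measurable_fun setT (@rV_cons R n).
Proof.
apply: measurable_fun_rVP => i.
rewrite (_ : (fun t => _) = (fun z : R * rV_space R n =>
  if unlift ord0 i is Some j then (z.2 : 'rV[R]_n) 0 j else z.1)); last first.
  by apply/funext => z; rewrite /rV_cons mxE.
case: unliftP => [j _|_]; last exact: measurable_fst.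
exact: (measurableT_comp (measurable_rV_coord j) measurable_snd).
Qed.

Lemma measurable_rV_uncons (R : realType) (n : nat) :
  measurable_fun setT (@rV_uncons R n).
Proof.
apply/measurable_fun_pairP; split; first exact: measurable_rV_coord.
apply: measurable_fun_rVP => i.
rewrite (_ : (fun t => _) = (fun x : rV_space R n.+1 =>
  (x : 'rV[R]_n.+1) 0 (lift ord0 i))); first exact: measurable_rV_coord.
by apply/funext => x; rewrite /= mxE.
Qed.

Section rV_product.
Variables (R : realType) (n : nat).
Variable m : {sigma_finite_measure set (rV_space R n) -> \bar R}.

Definition rV_product : set (rV_space R n.+1) -> \bar R :=
  pushforward (@lebesgue_measure R \x m)%E (@rV_cons R n).

Let rV_product0 : rV_product set0 = 0%E.
Proof. by rewrite /rV_product /pushforward preimage_set0 measure0. Qed.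

Let rV_product_ge0 A : (0 <= rV_product A)%E.
Proof. exact: (measure_ge0 (@lebesgue_measure R \x m)%E). Qed.

Let rV_product_sigma_additive : semi_sigma_additive rV_product.
Proof.
have mpre A : measurable A -> measurable (@rV_cons R n @^-1` A).
  by move=> mA; rewrite -[X in measurable X]setTI; exact: measurable_rV_cons.
move=> F mF tF mUF; rewrite /rV_product /pushforward preimage_bigcup.
apply: measure_semi_sigma_additive.
- by move=> k; exact: mpre.
- apply/trivIsetP => /= i j _ _ ij; rewrite -preimage_setI.
  by move/trivIsetP : tF => /(_ _ _ _ _ ij) ->//; rewrite preimage_set0.
- by rewrite -preimage_bigcup; exact: mpre.
Qed.

HB.instance Definition _ := isMeasure.Build _ _ _ rV_product
  rV_product0 rV_product_ge0 rV_product_sigma_additive.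

Let rV_product_sigma_finite : sigma_finite setT rV_product.
Proof.
have /sigma_finiteP[F [TF ndF Foo]] := sigma_finiteT (@lebesgue_measure R).
have /sigma_finiteP[G [TG ndG Goo]] := sigma_finiteT m.
exists (fun k => @rV_uncons R n @^-1` (F k `*` G k)).
  rewrite -preimage_bigcup (_ : \bigcup_k _ = setT) ?preimage_setT//.
  apply/seteqP; split => // -[x v] _.
  have [i _ Fix] : (\bigcup_k F k) x by rewrite -TF.
  have [j _ Gjv] : (\bigcup_k G k) v by rewrite -TG.
  exists (maxn i j) => //; split => /=.
  - by move: x Fix; exact/subsetPset/ndF/leq_maxl.
  - by move: v Gjv; exact/subsetPset/ndG/leq_maxr.
move=> k; have [mF oF] := Foo k; have [mG oG] := Goo k; split.
  rewrite -[X in measurable X]setTI; apply: measurable_rV_uncons => //.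
  exact: measurableX.
rewrite /rV_product /pushforward (_ : _ @^-1` _ = F k `*` G k).
  by rewrite product_measure1E// lte_mul_pinfty// ge0_fin_numE.
by apply/seteqP; split => z; rewrite /preimage /mkset rV_consK.
Qed.

HB.instance Definition _ := Measure_isSigmaFinite.Build _ _ _ rV_product
  rV_product_sigma_finite.

End rV_product.

Fixpoint borel_lebesgue (R : realType) (n : nat) :
    {sigma_finite_measure set (rV_space R n) -> \bar R} :=
  match n with
  | 0 => @dirac _ (rV_space R 0) (0 : 'rV[R]_0) R
  | n'.+1 => rV_product (borel_lebesgue R n')
  end.

Lemma borel_lebesgue_box (R : realType) (n : nat) (A : 'I_n -> set R) :
  (forall i, measurable (A i)) ->
  borel_lebesgue R n [set x | forall i, A i ((x : 'rV[R]_n) 0 i)] =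
  (\prod_(i < n) lebesgue_measure (A i))%E.
Proof.
elim: n A => [|n IH] A mA.
  rewrite big_ord0 /= diracE mem_set//= => -[].
  by case.
rewrite big_ord_recl /= /rV_product /pushforward.
pose B := [set x : rV_space R n |
  forall i, A (lift ord0 i) ((x : 'rV[R]_n) 0 i)].
rewrite (_ : _ @^-1` _ = A ord0 `*` B); last first.
  apply/seteqP; split => [[x v] /= Axv|[x v] [/= Ax Bv] i].
    split => /=; first by have := Axv ord0; rewrite mxE unlift_none.
    by move=> i; have := Axv (lift ord0 i); rewrite mxE liftK.
  by rewrite mxE; case: unliftP => [j ->|->].
have mB : measurable B.
  have -> : B = \big[setI/setT]_(i < n)
      (fun x : rV_space R n => (x : 'rV[R]_n) 0 i) @^-1` A (lift ord0 i).
    rewrite -bigcap_seq; apply/seteqP; split => x /= Bx i => [_|].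
      exact: Bx.
    by apply: (Bx i); rewrite /= mem_index_enum.
  apply: bigsetI_measurable => i _.
  by rewrite -[X in measurable X]setTI; exact: measurable_rV_coord.
apply: etrans (product_measure1E (@lebesgue_measure R) (borel_lebesgue R n)
  (mA ord0) mB) _; congr (_ * _)%E.
exact: (IH (fun i => A (lift ord0 i))).
Qed.

(* The Lebesgue sigma-algebra on R^n; its carrier is convertible to 'rV[R]_n. *)
Definition lebesgue_space (R : realType) (n : nat) : measurableType _ :=
  caratheodory_type (mu_ext (borel_lebesgue R n)).

Definition lebesgue_rV (R : realType) (n : nat) :
    {measure set (lebesgue_space R n) -> \bar R} :=
  @completed_measure_extension _ _ _ (borel_lebesgue R n).

Section real_sobolev.
Variables (R : realType) (n : nat).
Local Notation mu := (lebesgue_rV R n).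
Implicit Types (Omega : set 'rV[R]_n) (p : R) (u v psi : 'rV[R]_n -> R).

(* Functions on Omega are total functions of which only the values on Omega
   matter; [u \_ Omega] is the extension by zero. *)
Definition in_Lp p Omega u : Prop :=
  (u \_ Omega : lebesgue_space R n -> R) \in Lfun mu p%:E.

Definition partial (k : 'I_n) u : 'rV[R]_n -> R :=
  fun x => 'D_(delta_mx 0 k) u x.

Fixpoint class_C (m : nat) u : Prop :=
  match m with
  | 0 => continuous u
  | m'.+1 => continuous u /\
      forall k : 'I_n, (forall x, derivable u x (delta_mx 0 k)) /\
        class_C m' (partial k u)
  end.

Definition test_function Omega psi : Prop :=
  [/\ forall m, class_C m psi,
      compact (closure [set x | psi x != 0]) &
      closure [set x | psi x != 0] `<=` Omega].

Definition weak_partial Omega (k : 'I_n) u v : Prop :=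
  forall psi, test_function Omega psi ->
    \int[mu]_(x in Omega) (u x * partial k psi x) =
    - \int[mu]_(x in Omega) (v x * psi x).

Definition real_weak_gradient p Omega u (Du : 'I_n -> 'rV[R]_n -> R) : Prop :=
  forall k, in_Lp p Omega (Du k) /\ weak_partial Omega k u (Du k).

Definition real_W1p p Omega u : Prop :=
  in_Lp p Omega u /\ exists Du, real_weak_gradient p Omega u Du.

(* W^{1,p}-distance of (u, Du) to the test function psi. *)
Definition sobolev_dist p Omega u (Du : 'I_n -> 'rV[R]_n -> R) psi : \bar R :=
  ('N[mu]_p%:E[EFin \o ((fun x => u x - psi x)%R \_ Omega)] +
   \sum_(k < n)
     'N[mu]_p%:E[EFin \o ((fun x => Du k x - partial k psi x)%R \_ Omega)])%E.

(* Closure of the test functions in W^{1,p}; weak gradients are determined up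
   to null sets, hence the choice of the representative Du is immaterial. *)
Definition real_W01p p Omega u : Prop :=
  real_W1p p Omega u /\
  forall Du, real_weak_gradient p Omega u Du ->
    forall r : R, 0 < r -> exists2 psi, test_function Omega psi &
      (sobolev_dist p Omega u Du psi < r%:E)%E.

End real_sobolev.

Section complex_sobolev.
Variables (R : realType) (n N : nat).
Local Notation mu := (lebesgue_rV R n).
Implicit Types (Omega : set 'rV[R]_n) (p : R).
Implicit Types (u phi : 'rV[R]_n -> 'cV[R[i]]_N).
Implicit Types (F Du Dphi : 'rV[R]_n -> 'M[R[i]]_(N, n)).

Definition inner (F G : 'M[R[i]]_(N, n)) : R[i] :=
  \sum_(j < N) \sum_(k < n) F j k * conjc (G j k).

Definition frob (F : 'M[R[i]]_(N, n)) : R := Num.sqrt (complex.Re (inner F F)).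

Definition Lp_mx p Omega F : Prop :=
  forall j k, in_Lp p Omega (fun x => complex.Re (F x j k)) /\
              in_Lp p Omega (fun x => complex.Im (F x j k)).

Definition W1p p Omega u : Prop :=
  forall j, real_W1p p Omega (fun x => complex.Re (u x j 0)) /\
            real_W1p p Omega (fun x => complex.Im (u x j 0)).

Definition W01p p Omega u : Prop :=
  forall j, real_W01p p Omega (fun x => complex.Re (u x j 0)) /\
            real_W01p p Omega (fun x => complex.Im (u x j 0)).

Definition weak_gradient p Omega u Du : Prop :=
  forall j,
    real_weak_gradient p Omega (fun x => complex.Re (u x j 0))
      (fun k x => complex.Re (Du x j k)) /\
    real_weak_gradient p Omega (fun x => complex.Im (u x j 0))
      (fun k x => complex.Im (Du x j k)).

Definition complex_integral Omega (f : 'rV[R]_n -> R[i]) : R[i] :=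
  Complex (\int[mu]_(x in Omega) complex.Re (f x))
          (\int[mu]_(x in Omega) complex.Im (f x)).

(* Since 0 `^ r is 1 for r = 0 and 0 for r != 0, the products below vanish
   when eps = 0 and F = 0 (resp. F = G = 0), as the usual convention demands. *)
Definition p_field (p eps : R) (F : 'M[R[i]]_(N, n)) : 'M[R[i]]_(N, n) :=
  ((eps ^+ 2 + frob F ^+ 2) `^ ((p - 2) / 2))%:C%C *: F.

Definition structure_constants (p c1 c2 : R) : Prop :=
  [/\ 0 < c1, 0 < c2 &
  forall (F G : 'M[R[i]]_(N, n)) (eps : R), 0 <= eps <= 1 ->
    let w := (eps ^+ 2 + frob F ^+ 2 + frob G ^+ 2) `^ ((p - 2) / 2) in
    c1 * (w * frob (F - G) ^+ 2) <=
      complex.Re (inner (p_field p eps F - p_field p eps G) (F - G)) /\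
    frob (p_field p eps F - p_field p eps G) <= c2 * (w * frob (F - G))].

Definition class_E (nu L c1 c2 : R) Omega (a : 'rV[R]_n -> R[i]) : Prop :=
  let aR : lebesgue_space R n -> R := fun x => complex.Re (a x) in
  let aI : lebesgue_space R n -> R := fun x => complex.Im (a x) in
  let D : set (lebesgue_space R n) := Omega in
  [/\ measurable_fun D aR, measurable_fun D aI,
      exists M : R, forall x, Omega x -> `|aR x| <= M,
      exists M : R, forall x, Omega x -> `|aI x| <= M &
      {ae mu, forall x, Omega x ->
        [/\ nu < aR x - `|aI x|, aR x + `|aI x| < L &
            nu < c1 * aR x - c2 * `|aI x|]}].

(* As for real_W01p, the representatives of the gradients are immaterial. *)
Definition weak_solution (p eps : R) Omega (a : 'rV[R]_n -> R[i]) F u : Prop :=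
  W1p p Omega u /\
  forall Du, weak_gradient p Omega u Du ->
  forall phi, W01p p Omega phi ->
  forall Dphi, weak_gradient p Omega phi Dphi ->
    complex_integral Omega (fun x =>
      a x * ((eps ^+ 2 + frob (Du x) ^+ 2) `^ ((p - 2) / 2))%:C%C
        * inner (Du x) (Dphi x)) =
    complex_integral Omega (fun x => inner (F x) (Dphi x)).

End complex_sobolev.

(* Main.v *)
Require Import Defs.
From HB Require Import structures.
From mathcomp Require Import all_boot all_order all_algebra.
From mathcomp Require Import complex.
From mathcomp Require Import all_classical all_reals all_analysis.
From mathcomp Require Import measurable_realfun.
From mathcomp Require Import ring lra.

Set Implicit Arguments.
Unset Strict Implicit.
Unset Printing Implicit Defensive.

Import Order.TTheory GRing.Theory Num.Theory.
Import numFieldNormedType.Exports.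

Local Open Scope classical_set_scope.
Local Open Scope ring_scope.

(** The difference [phi = u1 - u2] has zero boundary values, so it is an
    admissible test function in both equations, and [Du1 - Du2] is a weak
    gradient of it. Subtracting the two equations gives
<<
      int_Omega a <A(Du1) - A(Du2), Du1 - Du2> = 0,   A = p_field p eps.
>>
    By Cauchy-Schwarz and the two structure inequalities the real part of the
    integrand is at least
      [(c1 Re a - c2 |Im a|) w |Du1 - Du2|^2 >= nu w |Du1 - Du2|^2],
    where [w] is the weight [(eps^2 + |Du1|^2 + |Du2|^2) `^ ((p - 2) / 2)]
    ([coercive_flux]). Hence it vanishes almost everywhere, and so does
    [Du1 - Du2] ([gradients_ae_eq]). The integrals may be subtracted because
    each integrand is dominated by a multiple of [H `^ p], where [H] is one plus
    the sum of the absolute values of all the entries of the gradients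
    ([integrable_flux]).

    It remains to see that a function of [W01p] whose gradient vanishes is zero
    ([real_W01p_eq0]). Test functions satisfy an L^1 Poincare inequality in the
    first coordinate: on each line parallel to the first axis the fundamental
    theorem of calculus bounds [psi] by the integral of [|d_0 psi|], and
    Tonelli's theorem integrates this over the lines
    ([poincare_test_function]). On a domain of finite measure the L^p norm
    controls the L^1 norm ([integral_le_Lnorm]). So if [psi] is close to [phi]
    in W^{1,p}, then [d_0 psi] is small in L^1, hence so is [psi], and hence so
    is [phi].

    The zero boundary condition is stated for every weak gradient of a function.
    It passes to differences because a weak gradient of [u - v] subtracted from
    one of [u] is one of [v] ([real_W01pB]). *)

(** * Lebesgue measure on R^n and Borel sets *)

Lemma measurable_rV_box (R : realType) (n : nat) (A : 'I_n -> set R) :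
  (forall i, measurable (A i)) ->
  measurable [set x : rV_space R n | forall i, A i ((x : 'rV[R]_n) 0 i)].
Proof.
move=> mA.
have -> : [set x : rV_space R n | forall i, A i ((x : 'rV[R]_n) 0 i)] =
    \big[setI/setT]_(i < n)
      (fun x : rV_space R n => (x : 'rV[R]_n) 0 i) @^-1` A i.
  rewrite -bigcap_seq; apply/seteqP; split => x /= Ax i => [_|].
    exact: Ax.
  by apply: (Ax i); rewrite /= mem_index_enum.
apply: bigsetI_measurable => i _.
by rewrite -[X in measurable X]setTI; exact: measurable_rV_coord.
Qed.

(** The sigma-algebra of [rV_space] is generated by the coordinates; it contains
    the open sets because an open set is a union of boxes with rational centres
    and radii [1 / m.+1], of which there are countably many. *)
Lemma open_measurable_rV (R : realType) (n : nat) (U : set 'rV[R]_n) :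
  open U -> measurable (U : set (rV_space R n)).
Proof.
move=> oU.
pose box (q : 'rV[rat]_n) (m : nat) : set (rV_space R n) :=
  [set x | forall i, `]ratr (q 0 i) - m.+1%:R^-1,
                       ratr (q 0 i) + m.+1%:R^-1[%classic ((x : 'rV[R]_n) 0 i)].
have mbox q m : measurable (box q m).
  exact: (measurable_rV_box (A := fun i => `](ratr (q 0 i) - m.+1%:R^-1),
    (ratr (q 0 i) + m.+1%:R^-1)[%classic)).
pose B (k : nat) : set (rV_space R n) :=
  if (unpickle k : option ('rV[rat]_n * nat)%type) is Some z then
    if `[< box z.1 z.2 `<=` U >] then box z.1 z.2 else set0
  else set0.
have -> : (U : set (rV_space R n)) = \bigcup_k B k.
  apply/seteqP; split => [x Ux|x [k _]]; last first.
    rewrite /B; case: unpickle => // z.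
    by case: asboolP => // + xz; exact.
  have : nbhs (x : 'rV[R]_n) U by move: oU; rewrite openE => /(_ _ Ux).
  move=> /nbhs_ballP[e /= e0 xeU].
  (* a radius [1 / m.+1] below [e / 2] keeps the box around a nearby rational
     point inside the ball of radius [e] *)
  pose m := Num.truncn (2 / e).
  have me : m.+1%:R^-1 < e / 2 :> R.
    rewrite invf_plt ?posrE ?divr_gt0// invf_div.
    by rewrite truncnS_gt.
  have qP i : exists q : rat, ratr q \in
      `](x : 'rV[R]_n) 0 i - m.+1%:R^-1, (x : 'rV[R]_n) 0 i + m.+1%:R^-1[.
    apply: rat_in_itvoo; rewrite ltrBlDr -addrA ltrDl.
    by rewrite addr_gt0.
  pose q : 'rV[rat]_n := \row_i sval (cid (qP i)).
  have xq i : `|(x : 'rV[R]_n) 0 i - ratr (q 0 i)| < m.+1%:R^-1.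
    rewrite mxE; case: cid => /= r; rewrite in_itv/= -ltr_distlC distrC.
    by rewrite distrC.
  exists (pickle (q, m)) => //; rewrite /B pickleK /=.
  have xbox : box q m x by move=> i; rewrite /= in_itv/= -ltr_distl.
  case: asboolP => // -[] y yq; apply: xeU; split => // i j.
  rewrite (ord1 i) /ball /=.
  have := yq j; rewrite /= in_itv/= -ltr_distl => yj.
  rewrite -(subrKA (ratr (q 0 j))) (le_lt_trans (ler_normD _ _))//.
  rewrite (splitr e) ltrD//; first exact: lt_trans (xq j) me.
  by rewrite distrC; exact: lt_trans yj me.
apply: bigcup_measurable => k _; rewrite /B.
by case: unpickle => // z; case: asboolP.
Qed.

Lemma continuous_measurable_rV (R : realType) (n : nat) (f : 'rV[R]_n -> R) :
  continuous f -> measurable_fun setT (f : rV_space R n -> R).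
Proof.
move=> cf; apply: (measurability _ (RGenOInfty.measurableE R)) => /=.
move=> _ [_ [a ->] <-]; rewrite setTI; apply: open_measurable_rV.
by apply: open_comp; [move=> + _; exact: cf|exact: interval_open].
Qed.

(** A Borel set keeps its measure in the completion, so Borel integrands may be
    integrated against the product measure, where Tonelli applies. *)
Section completion.
Variables (R : realType) (n : nat).

Lemma measurable_to_lebesgue (A : set (rV_space R n)) :
  measurable A -> measurable (A : set (lebesgue_space R n)).
Proof. exact: caratheodory_measurable_mu_ext. Qed.

Lemma measurable_fun_to_lebesgue d (T : measurableType d)
    (f : rV_space R n -> T) :
  measurable_fun setT f -> measurable_fun setT (f : lebesgue_space R n -> T).
Proof.
move=> mf _ Y mY; rewrite setTI; apply: measurable_to_lebesgue.
by rewrite -[X in measurable X]setTI; exact: mf.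
Qed.

Lemma lebesgue_rVE (A : set (rV_space R n)) :
  measurable A -> lebesgue_rV R n A = borel_lebesgue R n A.
Proof. exact: measurable_mu_extE. Qed.

Lemma ge0_integral_lebesgue_rV (f : rV_space R n -> \bar R) :
  measurable_fun setT f -> (forall x, 0 <= f x)%E ->
  (\int[lebesgue_rV R n]_x f x = \int[borel_lebesgue R n]_x f x)%E.
Proof.
move=> mf f0.
have mid : measurable_fun setT (id : lebesgue_space R n -> rV_space R n).
  by move=> _ Y mY; rewrite setTI; exact: measurable_to_lebesgue.
transitivity (\int[pushforward (lebesgue_rV R n)
    (id : lebesgue_space R n -> rV_space R n)]_x f x)%E.
  by rewrite ge0_integral_pushforward.
by apply: eq_measure_integral => A mA _; exact: lebesgue_rVE.
Qed.

End completion.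

Lemma ge0_integral_rV_cons (R : realType) (n : nat)
    (f : rV_space R n.+1 -> \bar R) :
  measurable_fun setT f -> (forall x, 0 <= f x)%E ->
  (\int[lebesgue_rV R n.+1]_x f x =
   \int[borel_lebesgue R n]_v \int[lebesgue_measure]_t f (rV_cons (t, v)))%E.
Proof.
move=> mf f0; rewrite ge0_integral_lebesgue_rV//=.
have mc := @measurable_rV_cons R n.
transitivity (\int[(@lebesgue_measure R \x borel_lebesgue R n)%E]_z
   f (rV_cons z))%E.
  transitivity (\int[pushforward (@lebesgue_measure R \x borel_lebesgue R n)%E
     (@rV_cons R n)]_x f x)%E.
    by apply: eq_measure_integral => A mA _; reflexivity.
  by rewrite ge0_integral_pushforward.
rewrite fubini_tonelli2//.
by apply: measurableT_comp => //; exact: measurable_rV_cons.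
Qed.

Lemma bounded_lebesgue_rV_lty (R : realType) (n : nat) (U : set 'rV[R]_n) :
  open U -> bounded_set U -> (lebesgue_rV R n U < +oo)%E.
Proof.
move=> oU [M [_ /(_ (M + 1))]]; rewrite ltrDl ltr01 => /(_ isT) UM.
pose B := [set x : rV_space R n |
  forall i, `[- (M + 1), M + 1]%classic ((x : 'rV[R]_n) 0 i)].
have mB : measurable B.
  exact: (measurable_rV_box (A := fun=> `[_, _]%classic)).
rewrite (@le_lt_trans _ _ (lebesgue_rV R n B))//.
  apply: le_measure.
  - by apply/mem_set/measurable_to_lebesgue; exact: open_measurable_rV.
  - by apply/mem_set/measurable_to_lebesgue.
  - move=> x /UM xM i; rewrite /= in_itv/= -ler_norml.
    apply: le_trans xM; rewrite [leRHS]/Num.norm/= mx_normrE.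
    exact: (le_bigmax _ (fun i => `|(x : 'rV[R]_n) i.1 i.2|) (0, i)).
rewrite lebesgue_rVE//.
have -> : borel_lebesgue R n B =
    (\prod_(i < n) lebesgue_measure `[(- (M + 1))%R, (M + 1)%R]%classic)%E.
  exact: (@borel_lebesgue_box R n (fun=> `[(- (M + 1)), (M + 1)]%classic)).
suff : (\prod_(i < n) lebesgue_measure `[(- (M + 1))%R, (M + 1)%R]%classic)%E
    \is a (@fin_num R) by rewrite ltey_eq => ->.
apply: (big_ind (fun y : \bar R => y \is a fin_num)) => //.
  by move=> x y xf yf; rewrite fin_numM.
by move=> i _; rewrite lebesgue_measure_itv; case: ifP.
Qed.

(** * The Poincare inequality on a line *)

Section poincare_line.
Variable R : realType.
Local Notation leb := (@lebesgue_measure R).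
Variables (h h' : R -> R) (b : R).
Hypothesis b_gt0 : 0 < b.
Hypothesis hh' : forall t : R, is_derive t (1 : R) h (h' t).
Hypothesis ch' : continuous h'.
Hypothesis h_out : forall t, b <= `|t| -> h t = 0.

Let ch : continuous h.
Proof.
move=> t; apply: differentiable_continuous.
by apply/derivable1_diffP; have [] := hh' t.
Qed.

Let mh' : measurable_fun setT (EFin \o (fun t => `|h' t|)).
Proof.
apply/measurable_EFinP; apply: measurableT_comp => //.
exact: continuous_measurable_fun.
Qed.

(** To the left of [- b] the function vanishes, so [h t] is the integral of [h']
    from [- b] to [t]. *)
Lemma normr_le_integral_derive t :
  (`|h t|%:E <= \int[leb]_s `|h' s|%:E)%E.
Proof.
have [bt|tb] := leP b `|t|.
  by rewrite h_out// normr0 integral_ge0.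
have Nbt : - b < t by move: tb; rewrite ltr_norml => /andP[].
have FTC : (\int[leb]_(s in `[(- b)%R, t]) (h' s)%:E = (h t)%:E)%E.
  have hb : h (- b) = 0 by rewrite h_out// normrN ger0_norm// ltW.
  rewrite (@continuous_FTC2 _ h' h)//.
  - by rewrite hb sube0.
  - by apply: continuous_subspaceT.
  - split; first by move=> x _; have [] := hh' x.
    + by apply: cvg_at_right_filter; exact: ch.
    + by apply: cvg_at_left_filter; exact: ch.
  - by move=> x _; rewrite derive1E; apply: derive_val.
rewrite -abse_EFin -FTC.
apply: le_trans.
  apply: le_abse_integral => //.
  apply/measurable_EFinP; apply: measurable_funTS.
  exact: continuous_measurable_fun.
exact: ge0_subset_integral.
Qed.

Lemma poincare_line :
  (\int[leb]_t `|h t|%:E <= (b + b)%:E * \int[leb]_t `|h' t|%:E)%E.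
Proof.
have mI : measurable (`[- b, b]%classic : set R) by exact: measurable_itv.
have h'0 : (0 <= \int[leb]_t `|h' t|%:E)%E by exact: integral_ge0.
rewrite (_ : (\int[leb]_t `|h t|%:E)%E =
    (\int[leb]_(t in `[(- b)%R, b]) `|h t|%:E)%E); last first.
  rewrite [RHS]integral_mkcond; apply: eq_integral => t _.
  rewrite patchE; case: ifPn => //.
  rewrite notin_setE /= in_itv/= -ler_norml => /negP.
  by rewrite -ltNge => /ltW /h_out ->; rewrite normr0.
apply: (@le_trans _ _
  (\int[leb]_(t in `[(- b)%R, b]) (\int[leb]_s `|h' s|%:E))%E).
  apply: ge0_le_integral => //.
  - apply/measurable_EFinP; apply: measurableT_comp => //.
    by apply: measurable_funTS; exact: continuous_measurable_fun.
  - by move=> t _; exact: normr_le_integral_derive.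
rewrite integral_cst//= lebesgue_measure_itv/= lte_fin gtrN// muleC.
by rewrite -EFinD opprK.
Qed.

End poincare_line.

Section slices.
Variables (R : realType) (n : nat).

(** Lines parallel to the first axis: they turn [partial ord0] into an ordinary
    derivative in the variable of integration of [ge0_integral_rV_cons]. *)
Lemma rV_consE (t : R) (v : rV_space R n) :
  rV_cons (t, v) = rV_cons (0, v) + t *: (delta_mx 0 ord0 : 'rV[R]_n.+1).
Proof.
apply/rowP => i; rewrite !mxE eqxx /=.
case: unliftP => [j ->|->] /=; first by rewrite mulr0 addr0.
by rewrite mulr1 add0r.
Qed.

Lemma is_derive_slice (u : 'rV[R]_n.+1 -> R) (v : rV_space R n) (t : R) :
  (forall x, derivable u x (delta_mx 0 ord0)) ->
  is_derive t (1 : R) (fun s => u (rV_cons (s, v)))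
    (partial ord0 u (rV_cons (t, v))).
Proof.
move=> du.
have E : (fun h : R => h^-1 *: (((fun s => u (rV_cons (s, v))) \o shift t)
      (h *: (1 : R)) - u (rV_cons (t, v)))) =
    (fun h => h^-1 *: ((u \o shift (rV_cons (t, v)))
      (h *: (delta_mx 0 ord0 : 'rV[R]_n.+1)) - u (rV_cons (t, v)))).
  apply/funext => h /=; congr (_ *: (u _ - _)).
  rewrite [h *: 1]mulr1 rV_consE [in RHS]rV_consE scalerDl.
  by rewrite addrCA addrA.
split; first by rewrite /derivable E; exact: du.
by rewrite /derive E.
Qed.

Lemma continuous_slice (u : 'rV[R]_n.+1 -> R) (v : rV_space R n) :
  continuous u -> continuous (fun s => u (rV_cons (s, v))).
Proof.
move=> cu t; rewrite (_ : (fun s => _) =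
    u \o (fun s : R => rV_cons (0, v) + s *: (delta_mx 0 ord0 : 'rV[R]_n.+1))).
  apply: continuous_comp; last exact: cu.
  apply: cvgD; first exact: cvg_cst.
  by apply: cvgZr_tmp; exact: cvg_id.
by apply/funext => s; rewrite rV_consE.
Qed.

End slices.

(** * The Poincare inequality for test functions *)

Section test_functions.
Variables (R : realType) (n : nat).
Implicit Types (Omega : set 'rV[R]_n) (psi chi : 'rV[R]_n -> R).

Lemma test_function_continuous Omega psi :
  test_function Omega psi -> continuous psi.
Proof. by move=> [/(_ 0%N)]. Qed.

Lemma test_function_derivable Omega psi k x :
  test_function Omega psi -> derivable psi x (delta_mx 0 k).
Proof. by move=> [/(_ 1%N)[_ /(_ k)[]]]. Qed.

Lemma test_function_partial_continuous Omega psi k :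
  test_function Omega psi -> continuous (partial k psi).
Proof. by move=> [/(_ 1%N)[_ /(_ k)[_]]]. Qed.

Lemma test_function_out Omega psi x :
  test_function Omega psi -> ~ Omega x -> psi x = 0.
Proof.
move=> [_ _ sub] xO; apply/eqP/negPn/negP => px.
by apply/xO/sub/subset_closure.
Qed.

(** Off [Omega] one is outside the closed support, so the function vanishes on a
    whole neighbourhood. *)
Lemma test_function_partial_out Omega psi k x :
  test_function Omega psi -> ~ Omega x -> partial k psi x = 0.
Proof.
move=> [_ _ sub] xO; rewrite /partial.
have nx : \forall y \near x, psi y = 0.
  have : open_nbhs x (~` closure [set x | psi x != 0]).
    by split; [exact/closed_openC/closed_closure|move=> /sub].
  move=> /open_nbhs_nbhs; apply: filterS => y /= yc.
  by apply/eqP/negPn/negP => py; apply/yc/subset_closure.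
by rewrite (near_eq_derive (g := cst 0))// derive_cst.
Qed.

Lemma partialB psi chi k x :
  derivable psi x (delta_mx 0 k) -> derivable chi x (delta_mx 0 k) ->
  partial k (fun y => psi y - chi y) x = partial k psi x - partial k chi x.
Proof. by move=> dp dc; rewrite /partial -deriveB. Qed.

Lemma class_CB m psi chi : class_C m psi -> class_C m chi ->
  class_C m (fun x => psi x - chi x).
Proof.
elim: m psi chi => [|m IH] psi chi.
  by move=> /= cp cc x; exact: (continuousB (cp x) (cc x)).
move=> [cp dp] [cc dc]; split.
  by move=> x; exact: (continuousB (cp x) (cc x)).
move=> k; have [dpk cpk] := dp k; have [dck cck] := dc k.
split; first by move=> x; apply: derivableB.
rewrite (_ : partial k _ = fun x => partial k psi x - partial k chi x).
  exact: IH.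
by apply/funext => x; exact: partialB.
Qed.

Lemma test_functionB Omega psi chi :
  test_function Omega psi -> test_function Omega chi ->
  test_function Omega (fun x => psi x - chi x).
Proof.
move=> [Cp kp sp] [Cc kc sc].
have sub : closure [set x | psi x - chi x != 0] `<=`
    closure [set x | psi x != 0] `|` closure [set x | chi x != 0].
  rewrite -closureU; apply: closureS => x /=.
  have [->|] := eqVneq (psi x) 0; last by left.
  have [->|] := eqVneq (chi x) 0; last by right.
  by rewrite subrr eqxx.
split.
- by move=> m; exact: class_CB.
- apply: subclosed_compact (compactU kp kc) sub; exact: closed_closure.
- by apply: subset_trans sub _ => x [/sp|/sc].
Qed.

End test_functions.

(** The one-dimensional inequality holds on each line parallel to the first
    axis with the same constant; Tonelli's theorem integrates it over the
    lines, since the integrands are nonnegative and Borel. *)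
Lemma poincare_test_function (R : realType) (n : nat)
    (Omega : set 'rV[R]_n.+1) : open Omega -> bounded_set Omega ->
  exists2 C : R, 0 <= C & forall psi, test_function Omega psi ->
    (\int[lebesgue_rV R n.+1]_(x in Omega) `|psi x|%:E <=
     C%:E * \int[lebesgue_rV R n.+1]_(x in Omega) `|partial ord0 psi x|%:E)%E.
Proof.
move=> oO [M0 [_ /(_ (`|M0| + 1))]].
rewrite (le_lt_trans (ler_norm _)) ?ltrDl// => /(_ isT).
set M := `|M0| + 1 => OM.
have M0' : 0 < M by rewrite ltr_wpDl.
pose b := M + 1.
have b0 : 0 < b by rewrite addr_gt0.
exists (b + b); first by rewrite addr_ge0 ?ltW.
move=> psi tpsi.
(* lines leave [Omega] at distance [b] from the hyperplane [x_0 = 0] *)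
have Oout t v : b <= `|t| -> ~ Omega (rV_cons (t, v)).
  move=> bt /OM; apply/negP; rewrite -ltNge.
  rewrite (lt_le_trans _ (le_trans bt _))// ?ltrDl//.
  rewrite [leRHS]/Num.norm/= mx_normrE.
  apply: le_trans
    (le_bigmax _ (fun i => `|(rV_cons (t, v)) i.1 i.2|) (0, ord0)).
  by rewrite /= mxE unlift_none.
have extend (f : 'rV[R]_n.+1 -> R) : continuous f ->
    (forall x, ~ Omega x -> f x = 0) ->
    (\int[lebesgue_rV R n.+1]_(x in Omega) `|f x|%:E =
     \int[borel_lebesgue R n]_v \int[lebesgue_measure]_t
       `|f (rV_cons (t, v))|%:E)%E.
  move=> cf f_out.
  rewrite -(ge0_integral_rV_cons (f := fun x => `|f x|%:E))//; last first.
    apply/measurable_EFinP; apply: measurableT_comp => //.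
    exact: continuous_measurable_rV.
  rewrite integral_mkcond; apply: eq_integral => x _.
  rewrite patchE; case: ifPn => //; rewrite notin_setE => /f_out ->.
  by rewrite normr0.
have mcons (f : 'rV[R]_n.+1 -> R) : continuous f -> measurable_fun setT
    (fun v : rV_space R n =>
       (\int[@lebesgue_measure R]_t `|f (rV_cons (t, v))|%:E)%E).
  move=> cf.
  have mf : measurable_fun setT
      (fun z : measurableTypeR R * rV_space R n => `|f (rV_cons z)|%:E).
    apply/measurable_EFinP; apply: measurableT_comp => //.
    apply: measurableT_comp; last exact: measurable_rV_cons.
    exact: continuous_measurable_rV.
  exact: (measurable_fun_fubini_tonelli_G (m1 := @lebesgue_measure R) _ mf).
have cpsi := test_function_continuous tpsi.
have cdpsi := test_function_partial_continuous (k := ord0) tpsi.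
rewrite !extend//; try by move=> x; exact: test_function_partial_out.
  rewrite -ge0_integralZl//; last 3 first.
  - exact: mcons.
  - by move=> v _; exact: integral_ge0.
  - by rewrite lee_fin addr_ge0 ?ltW.
  apply: ge0_le_integral => //.
  - by move=> v _; exact: integral_ge0.
  - exact: mcons.
  - by apply: measurable_funeM; exact: mcons.
  move=> v _.
  apply: (poincare_line (h := fun t => psi (rV_cons (t, v)))
    (h' := fun t => partial ord0 psi (rV_cons (t, v)))) => //.
  - move=> t; apply: is_derive_slice => x.
    exact: test_function_derivable tpsi.
  - exact: (continuous_slice (u := partial ord0 psi)).
  - by move=> t bt; apply: (test_function_out tpsi); exact: Oout.
by move=> x; exact: test_function_out.
Qed.

(** * Lebesgue and Sobolev functions on a bounded domain *)

Lemma continuous_measurable_lebesgue (R : realType) (n : nat)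
    (D : set (lebesgue_space R n)) (f : 'rV[R]_n -> R) :
  continuous f -> measurable_fun D (f : lebesgue_space R n -> R).
Proof.
move=> cf; apply: measurable_funTS; apply: measurable_fun_to_lebesgue.
exact: continuous_measurable_rV.
Qed.

(** Hoelder's inequality against the indicator of [D]. *)
Lemma integral_le_Lnorm d (T : measurableType d) (R : realType)
    (mu : {measure set T -> \bar R}) (D : set T) (p : R) :
  1 < p -> measurable D -> (mu D < +oo)%E ->
  exists2 C : R, 0 <= C & forall f : T -> R, measurable_fun D f ->
    (\int[mu]_(x in D) `|f x|%:E <= C%:E * 'N[mu]_p%:E[EFin \o (f \_ D)])%E.
Proof.
move=> p1 mD Dfin.
have p0 : 0 < p by rewrite (lt_trans ltr01).
have pB0 : 0 < p - 1 by rewrite subr_gt0.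
pose q := p / (p - 1).
have q0 : 0 < q by rewrite divr_gt0.
have pq : p^-1 + q^-1 = 1.
  by rewrite /q invf_div -{1}(mul1r p^-1) -mulrDl addrC subrK divff// gt_eqF.
have Nfin : ('N[mu]_q%:E[EFin \o \1_D] < +oo)%E.
  rewrite unlock /Lnorm poweR_lty//.
  rewrite (_ : (\int[mu]_x _)%E = (\int[mu]_x (\1_D x)%:E)%E).
    by rewrite integral_indic// setIT.
  apply: eq_integral => x _; rewrite /= indicE.
  by case: (x \in D); rewrite ?normr1 ?normr0 ?powR1// powR0// gt_eqF.
exists (fine 'N[mu]_q%:E[EFin \o \1_D]); first by rewrite fine_ge0// Lnorm_ge0.
move=> f mf.
rewrite fineK; last by rewrite ge0_fin_numE ?Lnorm_ge0.
have mfD : measurable_fun setT (f \_ D).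
  by apply/measurable_restrict => //; rewrite setTI.
have m1D : measurable_fun setT (\1_D : T -> R) by exact: measurable_indic.
have := hoelder mu mfD m1D p0 q0 pq.
rewrite muleC Lnorm1; apply: le_trans.
rewrite le_eqVlt; apply/orP; left; apply/eqP.
rewrite integral_mkcond; apply: eq_integral => x _ /=.
rewrite !patchE indicE; case: (x \in D) => /=; first by rewrite mulr1.
by rewrite mul0r normr0.
Qed.

Section real_Lp.
Variables (R : realType) (n : nat) (Omega : set 'rV[R]_n) (p : R).
Hypotheses (Omega_open : open Omega) (Omega_bounded : bounded_set Omega).
Hypothesis p1 : 1 < p.
Local Notation mu := (lebesgue_rV R n).
Local Notation OmegaL := (Omega : set (lebesgue_space R n)).
Implicit Types u v : 'rV[R]_n -> R.

Let p_ge1 : (1 <= p%:E)%E. Proof. by rewrite lee_fin ltW. Qed.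

Lemma measurable_domain : measurable OmegaL.
Proof. by apply: measurable_to_lebesgue; exact: open_measurable_rV. Qed.

Let mO := measurable_domain.

Lemma domain_lty : (mu OmegaL < +oo)%E.
Proof. exact: bounded_lebesgue_rV_lty. Qed.

Lemma in_LpD u v : in_Lp p Omega u -> in_Lp p Omega v ->
  in_Lp p Omega (fun x => u x + v x).
Proof.
rewrite /in_Lp => uL vL.
have -> : (fun x => u x + v x) \_ Omega = u \_ Omega + v \_ Omega.
  apply/funext => x; rewrite [RHS]/GRing.add /= !patchE.
  by case: ifP => //; rewrite addr0.
exact: (Lfun_addr_closed mu p_ge1).2.
Qed.

Lemma in_LpN u : in_Lp p Omega u -> in_Lp p Omega (fun x => - u x).
Proof.
rewrite /in_Lp => uL.
have -> : (fun x => - u x) \_ Omega = - (u \_ Omega).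
  apply/funext => x; rewrite [RHS]/GRing.opp /= !patchE.
  by case: ifP => //; rewrite oppr0.
exact: Lfun_oppr_closed.
Qed.

Lemma in_LpB u v : in_Lp p Omega u -> in_Lp p Omega v ->
  in_Lp p Omega (fun x => u x - v x).
Proof. by move=> uL vL; apply: in_LpD => //; exact: in_LpN. Qed.

Lemma in_Lp_measurable u : in_Lp p Omega u ->
  measurable_fun OmegaL (u : lebesgue_space R n -> R).
Proof.
move=> /sub_Lfun_mfun; rewrite inE /= => mu'.
by apply/(measurable_restrictT _ mO).
Qed.

Lemma in_Lp_norm u : in_Lp p Omega u -> in_Lp p Omega (fun x => `|u x|).
Proof.
rewrite /in_Lp => /andP[/[!inE]/= mu' fu].
have E : (fun x => `|u x|) \_ Omega = Num.norm \o (u \_ Omega).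
  apply/funext => x /=; rewrite !patchE.
  by case: ifP => //; rewrite normr0.
rewrite E; apply/andP; split; rewrite inE /=; first exact: measurableT_comp.
by move: fu; rewrite /finite_norm -Lnorm_abse.
Qed.

Lemma in_Lp_cst (c : R) : in_Lp p Omega (fun=> c).
Proof.
rewrite /in_Lp; apply/andP; split; rewrite inE /=.
  exact/(measurable_restrictT _ mO).
rewrite /finite_norm unlock /Lnorm poweR_lty//.
rewrite (_ : (\int[mu]_x _)%E = (\int[mu]_(x in OmegaL) (`|c| `^ p)%:E)%E).
  rewrite integral_cst// lte_mul_pinfty ?lee_fin ?powR_ge0//.
  exact: domain_lty.
rewrite [RHS]integral_mkcond; apply: eq_integral => x _ /=.
rewrite !patchE; case: ifP => //= _.
by rewrite normr0 powR0// gt_eqF// (lt_trans ltr01).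
Qed.

Lemma in_Lp_sum (I : Type) (s : seq I) (h : I -> 'rV[R]_n -> R) :
  (forall i, in_Lp p Omega (h i)) ->
  in_Lp p Omega (fun x => \sum_(i <- s) h i x).
Proof.
move=> Lh; elim: s => [|i s IH].
  have -> : (fun x : 'rV[R]_n => \sum_(i <- [::]) h i x) = fun=> 0.
    by apply/funext => x; rewrite big_nil.
  exact: in_Lp_cst.
have -> : (fun x : 'rV[R]_n => \sum_(j <- i :: s) h j x) =
    (fun x => h i x + \sum_(j <- s) h j x).
  by apply/funext => x; rewrite big_cons.
exact: in_LpD.
Qed.

Lemma in_Lp_powR_integrable u : in_Lp p Omega u ->
  mu.-integrable OmegaL (fun x => (`|u x| `^ p)%:E).
Proof.
move=> /(Lfun_integrable (ltW p1)) iu; apply/(integrable_mkcond _ mO).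
apply: eq_integrable iu => // x _ /=.
rewrite !patchE; case: ifP => //= _.
by rewrite normr0 powR0// gt_eqF// (lt_trans ltr01).
Qed.

Lemma in_Lp_integrable u : in_Lp p Omega u ->
  mu.-integrable OmegaL (EFin \o u).
Proof.
move=> Lu; have mu' := in_Lp_measurable Lu.
have [C C0 HC] := integral_le_Lnorm p1 mO domain_lty.
apply/integrableP; split; first exact/measurable_EFinP.
apply: le_lt_trans (HC _ mu') _.
rewrite lte_mul_pinfty//.
by move: Lu => /sub_Lfun_finLfun; rewrite inE.
Qed.

(** A continuous function is bounded on a closed ball that contains the domain;
    this applies to a test function and to its partial derivatives, and makes
    the integrals of [weak_partial] additive. *)
Lemma integrable_mul_continuous u (f : 'rV[R]_n -> R) :
  in_Lp p Omega u -> continuous f ->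
  mu.-integrable OmegaL (EFin \o (fun x => u x * f x)).
Proof.
move=> Lu cf.
have mf : measurable_fun OmegaL (f : lebesgue_space R n -> R).
  exact: continuous_measurable_lebesgue.
have [M HM] : exists M, forall x, Omega x -> `|f x| <= M.
  have [M [_ /(_ (M + 1))]] := Omega_bounded.
  rewrite ltrDl ltr01 => /(_ isT) OM.
  pose K : set 'rV[R]_n := [set x | `|x| <= M + 1].
  have cK : compact K.
    apply: bounded_closed_compact.
      exists (M + 1); split; first exact: num_real.
      by move=> y My x /le_trans; apply; exact: ltW.
    rewrite (_ : K = Num.norm @^-1` [set r : R | r <= M + 1]) //.
    apply: closed_comp; last exact: closed_le.
    by move=> x _; exact: norm_continuous.
  have : compact (f @` K).
    by apply: continuous_compact => //; exact: continuous_subspaceT.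
  move=> /compact_bounded[B [_ /(_ (B + 1))]].
  rewrite ltrDl ltr01 => /(_ isT) HB.
  by exists (B + 1) => x Ox; apply: HB; exists x => //; exact: OM.
have [mu' _] := integrableP _ _ _ (in_Lp_integrable Lu).
apply: (le_integrable mO (g := EFin \o (fun x => M * u x))).
- by apply/measurable_EFinP/measurable_funM => //; exact/measurable_EFinP.
- move=> x Ox /=; rewrite lee_fin !normrM mulrC ler_wpM2r//.
  by rewrite (le_trans (HM _ Ox))// ler_norm.
- exact: (integrableZl mO M (in_Lp_integrable Lu)).
Qed.

Lemma weak_partialB k u v Du Dv :
  in_Lp p Omega u -> in_Lp p Omega v ->
  in_Lp p Omega Du -> in_Lp p Omega Dv ->
  weak_partial Omega k u Du -> weak_partial Omega k v Dv ->
  weak_partial Omega k (fun x => u x - v x) (fun x => Du x - Dv x).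
Proof.
move=> Lu Lv LDu LDv wu wv psi tpsi.
have cpsi := test_function_continuous tpsi.
have cdpsi := test_function_partial_continuous (k := k) tpsi.
under eq_Rintegral do rewrite mulrBl.
under [in RHS]eq_Rintegral do rewrite mulrBl.
rewrite !RintegralB//; try exact: integrable_mul_continuous.
by rewrite wu// wv// opprB opprK addrC.
Qed.

Lemma real_weak_gradientB u v (Du Dv : 'I_n -> 'rV[R]_n -> R) :
  in_Lp p Omega u -> in_Lp p Omega v ->
  real_weak_gradient p Omega u Du -> real_weak_gradient p Omega v Dv ->
  real_weak_gradient p Omega (fun x => u x - v x) (fun k x => Du k x - Dv k x).
Proof.
move=> Lu Lv wu wv k; have [LDu wDu] := wu k; have [LDv wDv] := wv k.
by split; [exact: in_LpB|exact: weak_partialB].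
Qed.

Lemma real_W1pB u v : real_W1p p Omega u -> real_W1p p Omega v ->
  real_W1p p Omega (fun x => u x - v x).
Proof.
move=> [Lu [Du wu]] [Lv [Dv wv]]; split; first exact: in_LpB.
by exists (fun k x => Du k x - Dv k x); exact: real_weak_gradientB.
Qed.

Let measurable_diff u (f : 'rV[R]_n -> R) : in_Lp p Omega u -> continuous f ->
  measurable_fun setT ((fun x => u x - f x) \_ Omega : lebesgue_space R n -> R).
Proof.
move=> Lu cf; apply/(measurable_restrictT _ mO).
apply: measurable_funB; first exact: in_Lp_measurable.
exact: continuous_measurable_lebesgue.
Qed.

(* Minkowski's inequality, in the shape of the summands of [sobolev_dist]. *)
Let Lnorm_diff u v (f g : 'rV[R]_n -> R) :
  in_Lp p Omega u -> in_Lp p Omega v -> continuous f -> continuous g ->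
  ('N[mu]_p%:E[EFin \o ((fun x => (u x - v x) - (f x - g x))%R \_ Omega)] <=
   'N[mu]_p%:E[EFin \o ((fun x => u x - f x)%R \_ Omega)] +
   'N[mu]_p%:E[EFin \o ((fun x => v x - g x)%R \_ Omega)])%E.
Proof.
move=> Lu Lv cf cg.
have mv : measurable_fun setT
    (\- ((fun x => v x - g x) \_ Omega) : lebesgue_space R n -> R).
  by apply: measurableT_comp => //; exact: measurable_diff.
have := eminkowski mu (measurable_diff Lu cf) mv p_ge1.
rewrite [X in (_ <= _ + X)%E](_ : _ =
    'N[mu]_p%:E[EFin \o ((fun x => v x - g x)%R \_ Omega)]%E); last first.
  by rewrite -[RHS]oppe_Lnorm.
apply: le_trans; rewrite le_eqVlt; apply/orP; left; apply/eqP.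
apply: eq_Lnorm => x /=; rewrite !patchE; congr EFin.
by case: ifP => _; [ring|exact: (esym (subr0 (0 : R)))].
Qed.

(** Given a weak gradient [D] of [u - v] and some weak gradient [Du] of [u], the
    family [Du - D] is a weak gradient of [v], because [u - (u - v) = v]. Both
    [Du] and [Du - D] are approximated, as [real_W01p] speaks of every weak
    gradient, and hence so is their difference [D]. *)
Lemma real_W01pB u v : real_W01p p Omega u -> real_W01p p Omega v ->
  real_W01p p Omega (fun x => u x - v x).
Proof.
move=> [Wu Au] [Wv Av]; split; first exact: real_W1pB.
move=> D wD r r0.
have [Lu [Du wu]] := Wu; have [Lv _] := Wv.
pose Dv k x := Du k x - D k x.
have wv : real_weak_gradient p Omega v Dv.
  have := real_weak_gradientB Lu (in_LpB Lu Lv) wu wD.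
  have -> // : (fun x => u x - (u x - v x)) = v.
  by apply/funext => x; rewrite subKr.
have r20 : 0 < r / 2 by rewrite divr_gt0.
have [psi tpsi dpsi] := Au _ wu _ r20.
have [chi tchi dchi] := Av _ wv _ r20.
exists (fun x => psi x - chi x); first exact: test_functionB.
rewrite (splitr r) EFinD; apply: le_lt_trans (lteD dpsi dchi).
rewrite /sobolev_dist addeACA; apply: leeD.
  exact: (Lnorm_diff Lu Lv (test_function_continuous tpsi)
    (test_function_continuous tchi)).
rewrite -big_split /=; apply: lee_sum => k _.
have := Lnorm_diff (wu k).1 (wv k).1
  (test_function_partial_continuous (k := k) tpsi)
  (test_function_partial_continuous (k := k) tchi).
apply: le_trans; rewrite le_eqVlt; apply/orP; left; apply/eqP.
apply: eq_Lnorm => x /=; congr EFin; rewrite !patchE; case: ifP => // _.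
by rewrite (partialB (test_function_derivable tpsi)
  (test_function_derivable tchi)) subKr.
Qed.

End real_Lp.

(** * Vanishing gradient and zero boundary values *)

Lemma measurable_EFin_normr d (T : measurableType d) (R : realType)
    (D : set T) (f : T -> R) :
  measurable_fun D f -> measurable_fun D (fun x => `|f x|%:E).
Proof. by move=> mf; apply/measurable_EFinP; exact: measurableT_comp. Qed.

(** Stated for [lebesgue_rV], whose carrier is a defined name, so that instance
    search finds it. *)
#[local] Instance ae_filter_lebesgue_rV (R : realType) (n : nat) :
  Filter (nbhs (almost_everywhere (lebesgue_rV R n))).
Proof. exact: ae_filter_ringOfSetsType. Qed.

Section zero_gradient.
Variables (R : realType) (n : nat) (Omega : set 'rV[R]_n.+1) (p : R).
Local Notation mu := (lebesgue_rV R n.+1).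
Local Notation OmegaL := (Omega : set (lebesgue_space R n.+1)).

(** Approximate [u] by a test function [psi] up to [r] in the Sobolev distance.
    As [Du ord0] vanishes, [partial ord0 psi] is at most [C * r] in L^1, so
    [psi] is at most [P * C * r] there by the Poincare inequality, while
    [u - psi] is at most [C * r]. Let [r] tend to 0. *)
Lemma real_W01p_eq0 (u : 'rV[R]_n.+1 -> R) (Du : 'I_n.+1 -> 'rV[R]_n.+1 -> R) :
  open Omega -> bounded_set Omega -> 1 < p ->
  real_W01p p Omega u -> real_weak_gradient p Omega u Du ->
  {ae mu, forall x, Omega x -> Du ord0 x = 0} ->
  {ae mu, forall x, Omega x -> u x = 0}.
Proof.
move=> oO bO p1 [[Lu _] Au] wu Du0.
have mO := measurable_domain oO.
have mLu := in_Lp_measurable oO Lu.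
have mLDu := in_Lp_measurable oO (wu ord0).1.
have [C C0 HC] := integral_le_Lnorm p1 mO (domain_lty oO bO).
have [P P0 HP] := poincare_test_function oO bO.
set K := C + P * C.
have K0 : 0 <= K by rewrite addr_ge0 ?mulr_ge0.
have main r : 0 < r ->
    (\int[mu]_(x in OmegaL) `|u x|%:E <=
      K%:E * r%:E)%E.
  move=> r0.
  have [psi tpsi /ltW dpsi] := Au _ wu _ r0.
  have mpsi : measurable_fun OmegaL
      (psi : lebesgue_space R n.+1 -> R).
    exact/continuous_measurable_lebesgue/(test_function_continuous tpsi).
  have mdpsi : measurable_fun OmegaL
      (partial ord0 psi : lebesgue_space R n.+1 -> R).
    apply: continuous_measurable_lebesgue.
    exact: test_function_partial_continuous tpsi.
  have mdiff := measurable_funB mLu mpsi.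
  have mddiff := measurable_funB mLDu mdpsi.
  pose N0 := 'N[mu]_p%:E[EFin \o ((fun x => u x - psi x)%R \_ Omega)]%E.
  pose N1 := 'N[mu]_p%:E[EFin \o
    ((fun x => Du ord0 x - partial ord0 psi x)%R \_ Omega)]%E.
  have N0r : (N0 <= r%:E)%E.
    apply: le_trans dpsi; rewrite /sobolev_dist leeDl// sume_ge0// => k _.
    exact: Lnorm_ge0.
  have N1r : (N1 <= r%:E)%E.
    apply: le_trans dpsi; rewrite /sobolev_dist big_ord_recl/=.
    rewrite (le_trans _ (leeDr _ _)) ?Lnorm_ge0// leeDl// sume_ge0// => k _.
    exact: Lnorm_ge0.
  have diff_le : (\int[mu]_(x in OmegaL)
      `|(u x - psi x)%R|%:E <= C%:E * r%:E)%E.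
    apply: le_trans (HC (fun x => u x - psi x) _) _.
      exact: measurable_funB.
    by rewrite lee_wpmul2l// lee_fin.
  have grad_le : (\int[mu]_(x in OmegaL)
      `|partial ord0 psi x|%:E <= C%:E * r%:E)%E.
    have -> : (\int[mu]_(x in OmegaL)
        `|partial ord0 psi x|%:E = \int[mu]_(x in Omega)
        `|(Du ord0 x - partial ord0 psi x)%R|%:E)%E.
      apply: ge0_ae_eq_integral.
      - exact: mO.
      - exact: measurable_EFin_normr.
      - exact: measurable_EFin_normr mddiff.
      - by [].
      - by [].
      - by apply: filterS Du0 => x Dx Ox; rewrite Dx// sub0r normrN.
    apply: le_trans (HC (fun x => Du ord0 x - partial ord0 psi x) _) _.
      exact: measurable_funB.
    by rewrite lee_wpmul2l// lee_fin.
  apply: (@le_trans _ _ (\int[mu]_(x in OmegaL)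
      (`|(u x - psi x)%R|%:E + `|psi x|%:E))%E).
    apply: ge0_le_integral.
    - exact: mO.
    - by [].
    - exact: measurable_EFin_normr mLu.
    - exact: emeasurable_funD (measurable_EFin_normr mdiff)
        (measurable_EFin_normr mpsi).
    - move=> x _; rewrite -EFinD lee_fin.
      by rewrite -{1}(subrK (psi x) (u x)) ler_normD.
  rewrite (ge0_integralD _ mO _ (measurable_EFin_normr mdiff) _
    (measurable_EFin_normr mpsi))//.
  rewrite /K EFinD muleDl// leeD//.
  apply: le_trans (HP _ tpsi) _.
  by rewrite EFinM -muleA lee_wpmul2l// lee_fin.
have u0 : (\int[mu]_(x in OmegaL) `|u x|%:E = 0)%E.
  apply/eqP; rewrite eq_le integral_ge0// andbT.
  apply/lee_addgt0Pr => e e0; rewrite add0e.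
  have eK : 0 < e / (K + 1) by rewrite divr_gt0// ltr_wpDl.
  apply: le_trans (main _ eK) _.
  rewrite -EFinM lee_fin mulrCA -[leRHS]mulr1 ler_pM2l//.
  by rewrite ler_pdivrMr ?ltr_wpDl// mul1r lerDl.
have /ae_eq_integral_abs : measurable_fun
    OmegaL (EFin \o u).
  exact/measurable_EFinP.
move=> /(_ (mu) mO)[/(_ u0) + _].
by apply: filterS => x + Ox => /(_ Ox) /= [].
Qed.

End zero_gradient.

(** * Algebra of complex matrices and pointwise estimates on the flux *)

Section complex_matrices.
Variables (R : realType) (N n : nat).
Implicit Types (F G V D : 'M[R[i]]_(N, n)) (z : R[i]).

Let ReM (x y : R[i]) : complex.Re (x * y) =
  complex.Re x * complex.Re y - complex.Im x * complex.Im y.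
Proof. by case: x y => [? ?] [? ?]. Qed.

Let ReD (x y : R[i]) : complex.Re (x + y) = complex.Re x + complex.Re y.
Proof. by case: x y => [? ?] [? ?]. Qed.

Let ImD (x y : R[i]) : complex.Im (x + y) = complex.Im x + complex.Im y.
Proof. by case: x y => [? ?] [? ?]. Qed.

Let Re_sum (I : finType) (h : I -> R[i]) :
  complex.Re (\sum_i h i) = \sum_i complex.Re (h i).
Proof. exact: (big_morph (@complex.Re R) ReD). Qed.

Let Im_sum (I : finType) (h : I -> R[i]) :
  complex.Im (\sum_i h i) = \sum_i complex.Im (h i).
Proof. exact: (big_morph (@complex.Im R) ImD). Qed.

Lemma Re_inner F G : complex.Re (inner F G) =
  \sum_(z : 'I_N * 'I_n) (complex.Re (F z.1 z.2) * complex.Re (G z.1 z.2) +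
    complex.Im (F z.1 z.2) * complex.Im (G z.1 z.2)).
Proof.
rewrite /inner Re_sum.
rewrite (eq_bigr (fun j => \sum_k complex.Re (F j k * conjc (G j k)))).
  rewrite pair_bigA /=; apply: eq_bigr => -[j k] _ /=.
  by case: (F j k) (G j k) => [? ?] [? ?] /=; rewrite mulrN opprK.
by move=> j _; rewrite Re_sum.
Qed.

Lemma Im_inner F G : complex.Im (inner F G) =
  \sum_(z : 'I_N * 'I_n) (complex.Im (F z.1 z.2) * complex.Re (G z.1 z.2) +
    - complex.Re (F z.1 z.2) * complex.Im (G z.1 z.2)).
Proof.
rewrite /inner Im_sum.
rewrite (eq_bigr (fun j => \sum_k complex.Im (F j k * conjc (G j k)))).
  rewrite pair_bigA /=; apply: eq_bigr => -[j k] _ /=.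
  by case: (F j k) (G j k) => [? ?] [? ?] /=; ring.
by move=> j _; rewrite Im_sum.
Qed.

Lemma frob_ge0 F : 0 <= frob F. Proof. exact: sqrtr_ge0. Qed.

Lemma sqr_frob F : frob F ^+ 2 = \sum_(z : 'I_N * 'I_n)
  (complex.Re (F z.1 z.2) ^+ 2 + complex.Im (F z.1 z.2) ^+ 2).
Proof.
rewrite /frob sqr_sqrtr; first by rewrite Re_inner.
by rewrite Re_inner sumr_ge0// => z _; rewrite addr_ge0// -expr2 sqr_ge0.
Qed.

Lemma frob_eq0 F : frob F = 0 -> F = 0.
Proof.
move=> F0; have := sqr_frob F; rewrite F0 expr0n /= => /esym /eqP.
rewrite psumr_eq0; last by move=> z _; rewrite addr_ge0 ?sqr_ge0.
move=> /allP H; apply/matrixP => j k; rewrite mxE.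
have := H (j, k); rewrite mem_index_enum => /(_ isT) /=.
rewrite paddr_eq0 ?sqr_ge0// !sqrf_eq0.
by case: (F j k) => [x y] /= /andP[/eqP -> /eqP ->].
Qed.

Let cauchy_schwarz (I : finType) (f f' g g' : I -> R) :
  (\sum_i (f i * g i + f' i * g' i)) ^+ 2 <=
  (\sum_i (f i ^+ 2 + f' i ^+ 2)) * (\sum_i (g i ^+ 2 + g' i ^+ 2)).
Proof.
set S := \sum_i (_ * _ + _); set A := \sum_i (f _ ^+ 2 + _).
set B := \sum_i (g _ ^+ 2 + _).
have B0 : 0 <= B by rewrite sumr_ge0// => i _; rewrite addr_ge0 ?sqr_ge0.
(* the squared length of [B f - S g] is [B (A B - S^2)] *)
have : 0 <= \sum_i ((B * f i - S * g i) ^+ 2 + (B * f' i - S * g' i) ^+ 2).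
  by rewrite sumr_ge0// => i _; rewrite addr_ge0 ?sqr_ge0.
have -> : \sum_i ((B * f i - S * g i) ^+ 2 + (B * f' i - S * g' i) ^+ 2) =
    B * (A * B - S ^+ 2).
  transitivity (B ^+ 2 * A - B * S *+ 2 * S + S ^+ 2 * B); last by ring.
  have -> : B ^+ 2 * A - B * S *+ 2 * S + S ^+ 2 * B =
      \sum_i B ^+ 2 * (f i ^+ 2 + f' i ^+ 2) -
      \sum_i B * S *+ 2 * (f i * g i + f' i * g' i) +
      \sum_i S ^+ 2 * (g i ^+ 2 + g' i ^+ 2) by rewrite -!mulr_sumr.
  by rewrite -sumrB -big_split /=; apply: eq_bigr => i _; ring.
move: B0; rewrite le_eqVlt => /predU1P[B0|B0].
  move=> _; suff -> : S = 0 by rewrite expr0n /= -B0 mulr0.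
  rewrite /S big1// => i _.
  have /esym/eqP := B0; rewrite psumr_eq0; last first.
    by move=> z _; rewrite addr_ge0 ?sqr_ge0.
  move=> /allP /(_ i); rewrite mem_index_enum => /(_ isT) /=.
  rewrite paddr_eq0 ?sqr_ge0// !sqrf_eq0 => /andP[/eqP -> /eqP ->].
  by rewrite !mulr0 addr0.
by rewrite pmulr_rge0// subr_ge0.
Qed.

Let le_frobM (x : R) F G :
  x ^+ 2 <= frob F ^+ 2 * frob G ^+ 2 -> `|x| <= frob F * frob G.
Proof.
move=> xFG; rewrite -(ler_pXn2r (n := 2))// ?nnegrE ?mulr_ge0 ?frob_ge0//.
by rewrite real_normK ?num_real// exprMn.
Qed.

Lemma normr_Re_inner F G : `|complex.Re (inner F G)| <= frob F * frob G.
Proof. by apply: le_frobM; rewrite Re_inner !sqr_frob cauchy_schwarz. Qed.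

Lemma normr_Im_inner F G : `|complex.Im (inner F G)| <= frob F * frob G.
Proof.
apply: le_frobM; rewrite Im_inner !sqr_frob.
apply: le_trans (cauchy_schwarz _ _ _ _) _.
rewrite le_eqVlt; apply/orP; left; apply/eqP; congr (_ * _).
by apply: eq_bigr => z _; rewrite sqrrN addrC.
Qed.

Lemma frob_le_sum F : frob F <= \sum_(z : 'I_N * 'I_n)
  (`|complex.Re (F z.1 z.2)| + `|complex.Im (F z.1 z.2)|).
Proof.
set s := \sum_z _.
have s0 : 0 <= s by rewrite sumr_ge0// => z _; rewrite addr_ge0.
rewrite -(ler_pXn2r (n := 2))// ?nnegrE ?frob_ge0// sqr_frob expr2 {1}/s.
rewrite mulr_suml ler_sum// => z _.
have zs : `|complex.Re (F z.1 z.2)| + `|complex.Im (F z.1 z.2)| <= s.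
  by rewrite /s (bigD1 z)//= lerDl sumr_ge0// => y _; rewrite addr_ge0.
apply: (@le_trans _ _ ((`|complex.Re (F z.1 z.2)| + `|complex.Im (F z.1 z.2)|)
   ^+ 2)); last by rewrite expr2 ler_wpM2l// addr_ge0.
rewrite -[in leLHS](real_normK (num_real (complex.Re _))).
rewrite -[in leLHS](real_normK (num_real (complex.Im _))).
by rewrite sqrrD addrAC lerDl mulrn_wge0// mulr_ge0.
Qed.

Lemma innerBl F G D : inner (F - G) D = inner F D - inner G D.
Proof.
rewrite /inner -sumrB; apply: eq_bigr => j _; rewrite -sumrB.
by apply: eq_bigr => k _; rewrite !mxE mulrBl.
Qed.

Lemma innerZl (w : R) F D : inner (w%:C%C *: F) D = w%:C%C * inner F D.
Proof.
rewrite /inner mulr_sumr; apply: eq_bigr => j _; rewrite mulr_sumr.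
by apply: eq_bigr => k _; rewrite !mxE mulrA.
Qed.

Lemma Re_flux (a : R[i]) (w : R) F D :
  complex.Re (a * w%:C%C * inner F D) =
  w * (complex.Re a * complex.Re (inner F D) -
       complex.Im a * complex.Im (inner F D)).
Proof. by case: a (inner F D) => [x y] [s t] /=; ring. Qed.

Lemma normr_Re_flux (a : R[i]) (w : R) F D : 0 <= w ->
  `|complex.Re (a * w%:C%C * inner F D)| <=
  (`|complex.Re a| + `|complex.Im a|) * (w * frob F * frob D).
Proof.
move=> w0; rewrite Re_flux normrM (ger0_norm w0) -[w * _ * _]mulrA mulrCA.
rewrite ler_wpM2l// (le_trans (ler_normB _ _))// !normrM mulrDl.
by rewrite lerD// ler_wpM2l// ?normr_Re_inner ?normr_Im_inner.
Qed.

(** The real part of [a * z] is [Re a * Re z - Im a * Im z]. Monotonicity bounds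
    [Re z] from below with [c1]; the term [Im a * Im z] is a loss, bounded
    through Cauchy-Schwarz and the Lipschitz estimate with [c2]. *)
Lemma coercive_flux (p eps c1 c2 nu : R) (a : R[i]) F G :
  0 <= eps <= 1 -> structure_constants n N p c1 c2 -> 0 <= complex.Re a ->
  nu <= c1 * complex.Re a - c2 * `|complex.Im a| ->
  nu * ((eps ^+ 2 + frob F ^+ 2 + frob G ^+ 2) `^ ((p - 2) / 2) *
        frob (F - G) ^+ 2) <=
  complex.Re (a * inner (p_field p eps F - p_field p eps G) (F - G)).
Proof.
move=> e01 [c10 c20 /(_ F G eps e01)] /=.
set w := (_ `^ _); set V := p_field _ _ F - _; set D := F - G.
move=> [mono lip] a0 na.
have w0 : 0 <= w by exact: powR_ge0.
have D0 := frob_ge0 D.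
have wD0 : 0 <= w * frob D ^+ 2 by rewrite mulr_ge0 ?sqr_ge0.
have Im_le : `|complex.Im (inner V D)| <= c2 * (w * frob D ^+ 2).
  apply: le_trans (normr_Im_inner _ _) _.
  by rewrite expr2 !mulrA ler_wpM2r// -mulrA.
apply: (@le_trans _ _ ((c1 * complex.Re a - c2 * `|complex.Im a|) *
    (w * frob D ^+ 2))); first by rewrite ler_wpM2r.
rewrite ReM mulrBl lerB//.
  by rewrite [c1 * _]mulrC -mulrA ler_wpM2l.
apply: le_trans (ler_norm _) _.
by rewrite normrM [c2 * _]mulrC -mulrA ler_wpM2l.
Qed.

(** A power vanishes only if its base does, and a zero base forces both matrices
    to be zero. *)
Lemma weight_sqr_frob_eq0 (r eps : R) F G :
  (eps ^+ 2 + frob F ^+ 2 + frob G ^+ 2) `^ r * frob (F - G) ^+ 2 = 0 ->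
  F - G = 0.
Proof.
move=> /eqP; rewrite mulf_eq0 sqrf_eq0 => /orP[|/eqP]; last exact: frob_eq0.
rewrite powR_eq0 => /andP[+ _].
rewrite paddr_eq0 ?addr_ge0 ?sqr_ge0// paddr_eq0 ?sqr_ge0// !sqrf_eq0.
by move=> /andP[/andP[_ /eqP/frob_eq0 ->] /eqP/frob_eq0 ->]; rewrite subr0.
Qed.

(** The flux grows like the power [p - 1] of the gradient, so paired with
    another gradient it is controlled by a [p]-th power. For [p < 2] and
    [eps = 0] the weight alone blows up near 0, so it is estimated together with
    [frob F], which is at most the square root of the base. *)
Lemma growth_flux (p eps h : R) F D : 1 < p -> 0 <= eps <= 1 ->
  1 + frob F + frob D <= h ->
  (eps ^+ 2 + frob F ^+ 2) `^ ((p - 2) / 2) * frob F * frob D <= h `^ p.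
Proof.
move=> p1 /andP[e0 e1] Fh.
have F0 := frob_ge0 F; have D0 := frob_ge0 D.
have h0 : 0 < h by apply: lt_le_trans Fh; rewrite -addrA ltr_wpDr ?addr_ge0.
set b := eps ^+ 2 + frob F ^+ 2.
have b0 : 0 <= b by rewrite addr_ge0 ?sqr_ge0.
have step : b `^ ((p - 2) / 2) * frob F <= h `^ (p - 1).
  have bh : b <= h ^+ 2.
    apply: (@le_trans _ _ ((1 + frob F) ^+ 2)).
      have : eps ^+ 2 <= 1 by exact: exprn_ile1.
      rewrite /b; nra.
    by rewrite ler_pXn2r// ?nnegrE; lra.
  have bE : b `^ ((p - 1) / 2) <= h `^ (p - 1).
    rewrite (_ : h `^ (p - 1) = (h ^+ 2) `^ ((p - 1) / 2)).
      by rewrite ge0_ler_powR ?nnegrE ?sqr_ge0//; lra.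
    rewrite -powR_mulrn ?ltW// -powRrM; congr (_ `^ _); lra.
  apply: le_trans bE.
  have [b00|bN0] := eqVneq b 0.
    have -> : frob F = 0.
      move/eqP: b00; rewrite paddr_eq0 ?sqr_ge0// !sqrf_eq0.
      by move=> /andP[_ /eqP].
    by rewrite mulr0 powR_ge0.
  rewrite (_ : (p - 1) / 2 = (p - 2) / 2 + 2^-1); last by lra.
  rewrite powRD; last by rewrite bN0 implybT.
  rewrite ler_wpM2l ?powR_ge0// powR12_sqrt//.
  rewrite -(ger0_norm F0) -sqrtr_sqr ler_wsqrtr// /b lerDr sqr_ge0//.
rewrite (_ : h `^ p = h `^ (p - 1) * h); last first.
  rewrite -{3}(powRr1 (ltW h0)) -powRD ?subrK//.
  by rewrite (gt_eqF h0) implybT.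
apply: ler_pM => //; first by rewrite mulr_ge0 ?powR_ge0.
lra.
Qed.

End complex_matrices.

(** * Weak gradients of complex functions and integrals of the flux *)

Section weak_gradients.
Variables (R : realType) (n N : nat) (Omega : set 'rV[R]_n) (p : R).
Hypotheses (Omega_open : open Omega) (Omega_bounded : bounded_set Omega).
Hypothesis p1 : 1 < p.
Local Notation mu := (lebesgue_rV R n).
Local Notation OmegaL := (Omega : set (lebesgue_space R n)).
Implicit Types (u v : 'rV[R]_n -> 'cV[R[i]]_N).
Implicit Types (F G Du Dv : 'rV[R]_n -> 'M[R[i]]_(N, n)).

Let mO := measurable_domain Omega_open.

Let ReB (x y : R[i]) : complex.Re (x - y) = complex.Re x - complex.Re y.
Proof. by case: x y => [? ?] [? ?]. Qed.

Let ImB (x y : R[i]) : complex.Im (x - y) = complex.Im x - complex.Im y.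
Proof. by case: x y => [? ?] [? ?]. Qed.

Lemma W1p_weak_gradient u : W1p p Omega u ->
  exists Du, weak_gradient p Omega u Du.
Proof.
move=> Wu.
pose DR j := sval (cid (Wu j).1.2).
pose DI j := sval (cid (Wu j).2.2).
exists (fun x => \matrix_(j, k) Complex (DR j k x) (DI j k x)) => j; split.
- rewrite (_ : (fun k x => _) = DR j); first exact: svalP (cid (Wu j).1.2).
  by apply/funext => k; apply/funext => x; rewrite mxE.
- rewrite (_ : (fun k x => _) = DI j); first exact: svalP (cid (Wu j).2.2).
  by apply/funext => k; apply/funext => x; rewrite mxE.
Qed.

Lemma weak_gradient_Lp u Du : weak_gradient p Omega u Du -> Lp_mx p Omega Du.
Proof. by move=> wu j k; have [/(_ k)[? _] /(_ k)[? _]] := wu j. Qed.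

Lemma weak_gradientB u v Du Dv : W1p p Omega u -> W1p p Omega v ->
  weak_gradient p Omega u Du -> weak_gradient p Omega v Dv ->
  weak_gradient p Omega (fun x => u x - v x) (fun x => Du x - Dv x).
Proof.
move=> Wu Wv wu wv j.
have [[[LRu _] [LIu _]] [[LRv _] [LIv _]]] := (Wu j, Wv j).
have [[wRu wIu] [wRv wIv]] := (wu j, wv j).
split.
- have := real_weak_gradientB Omega_open Omega_bounded p1 LRu LRv wRu wRv.
  congr real_weak_gradient.
  + by apply/funext => x; rewrite !mxE ReB.
  + by apply/funext => k; apply/funext => x; rewrite !mxE ReB.
- have := real_weak_gradientB Omega_open Omega_bounded p1 LIu LIv wIu wIv.
  congr real_weak_gradient.
  + by apply/funext => x; rewrite !mxE ImB.
  + by apply/funext => k; apply/funext => x; rewrite !mxE ImB.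
Qed.

(** [u - v = (u - g) - (v - g)]. *)
Lemma W01p_sub_boundary u v g :
  W01p p Omega (fun x => u x - g x) -> W01p p Omega (fun x => v x - g x) ->
  W01p p Omega (fun x => u x - v x).
Proof.
move=> Wu Wv j; have [[WRu WIu] [WRv WIv]] := (Wu j, Wv j); split.
- have := real_W01pB Omega_open Omega_bounded p1 WRu WRv.
  congr real_W01p; apply/funext => x; rewrite !mxE !ReB; ring.
- have := real_W01pB Omega_open Omega_bounded p1 WIu WIv.
  congr real_W01p; apply/funext => x; rewrite !mxE !ImB; ring.
Qed.

Let measurable_Re F j k : Lp_mx p Omega F -> measurable_fun OmegaL
  (fun x : lebesgue_space R n => complex.Re (F x j k)).
Proof. by move=> /(_ j k)[/(in_Lp_measurable Omega_open)]. Qed.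

Let measurable_Im F j k : Lp_mx p Omega F -> measurable_fun OmegaL
  (fun x : lebesgue_space R n => complex.Im (F x j k)).
Proof. by move=> /(_ j k)[_ /(in_Lp_measurable Omega_open)]. Qed.

Lemma measurable_Re_inner F G : Lp_mx p Omega F -> Lp_mx p Omega G ->
  measurable_fun OmegaL
    (fun x : lebesgue_space R n => complex.Re (inner (F x) (G x))).
Proof.
move=> LF LG; under eq_fun do rewrite Re_inner.
apply: measurable_sum => z.
by apply: measurable_funD; apply: measurable_funM;
  [exact: measurable_Re|exact: measurable_Re|
   exact: measurable_Im|exact: measurable_Im].
Qed.

Lemma measurable_Im_inner F G : Lp_mx p Omega F -> Lp_mx p Omega G ->
  measurable_fun OmegaL
    (fun x : lebesgue_space R n => complex.Im (inner (F x) (G x))).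
Proof.
move=> LF LG; under eq_fun do rewrite Im_inner.
apply: measurable_sum => z.
apply: measurable_funD; apply: measurable_funM.
- exact: measurable_Im.
- exact: measurable_Re.
- apply: (measurableT_comp (@oppr_measurable R setT)).
  exact: measurable_Re.
- exact: measurable_Im.
Qed.

Lemma in_Lp_sum_norm F : Lp_mx p Omega F ->
  in_Lp p Omega (fun x => \sum_(z : 'I_N * 'I_n)
    (`|complex.Re (F x z.1 z.2)| + `|complex.Im (F x z.1 z.2)|)).
Proof.
move=> LF; apply: (in_Lp_sum Omega_open Omega_bounded p1) => z.
have [LR LI] := LF z.1 z.2.
by apply: in_LpD => //; exact: in_Lp_norm.
Qed.

(** The real part of the integrand of the equation, with the gradient [F] of the
    solution and the gradient [G] of the test function; coercivity is
    a property of real parts. *)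
Definition flux (eps : R) (a : 'rV[R]_n -> R[i]) F G (x : 'rV[R]_n) : R :=
  complex.Re (a x * ((eps ^+ 2 + frob (F x) ^+ 2) `^ ((p - 2) / 2))%:C%C
    * inner (F x) (G x)).

Lemma integrable_flux (eps M : R) (a : 'rV[R]_n -> R[i]) F G :
  0 <= eps <= 1 ->
  measurable_fun OmegaL (fun x : lebesgue_space R n => complex.Re (a x)) ->
  measurable_fun OmegaL (fun x : lebesgue_space R n => complex.Im (a x)) ->
  (forall x, Omega x -> `|complex.Re (a x)| + `|complex.Im (a x)| <= M) ->
  Lp_mx p Omega F -> Lp_mx p Omega G ->
  mu.-integrable OmegaL (EFin \o (flux eps a F G : lebesgue_space R n -> R)).
Proof.
move=> e01 maR maI aM LF LG.
pose H (x : 'rV[R]_n) := 1 + \sum_(z : 'I_N * 'I_n)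
    (`|complex.Re (F x z.1 z.2)| + `|complex.Im (F x z.1 z.2)|) +
  \sum_(z : 'I_N * 'I_n)
    (`|complex.Re (G x z.1 z.2)| + `|complex.Im (G x z.1 z.2)|).
have LH : in_Lp p Omega H.
  apply: in_LpD => //; last exact: in_Lp_sum_norm.
  by apply: in_LpD => //; [exact: in_Lp_cst|exact: in_Lp_sum_norm].
have HE x : 1 + frob (F x) + frob (G x) <= H x.
  by rewrite /H lerD ?frob_le_sum// lerD ?frob_le_sum.
have mw : measurable_fun OmegaL (fun x : lebesgue_space R n =>
    (eps ^+ 2 + frob (F x) ^+ 2) `^ ((p - 2) / 2)).
  apply: (measurableT_comp (measurable_powR _)).
  apply: measurable_funD; first exact: measurable_cst.
  under eq_fun do rewrite sqr_frob.
  apply: measurable_sum => z.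
  by apply: measurable_funD; apply: measurable_funX;
    [exact: measurable_Re|exact: measurable_Im].
apply: (le_integrable mO (g := fun x => (M * `|H x| `^ p)%:E)).
- apply/measurable_EFinP; rewrite /flux; under eq_fun do rewrite Re_flux.
  exact: (measurable_funM mw (measurable_funB
    (measurable_funM maR (measurable_Re_inner LF LG))
    (measurable_funM maI (measurable_Im_inner LF LG)))).
- move=> x Ox /=; rewrite lee_fin.
  have H0 : 0 <= H x by apply: le_trans (HE x); rewrite !addr_ge0 ?frob_ge0.
  have M0 : 0 <= M by apply: le_trans (aM x Ox); rewrite addr_ge0.
  rewrite (ger0_norm H0) [leRHS]ger0_norm ?mulr_ge0 ?powR_ge0//.
  apply: le_trans (normr_Re_flux _ _ _ _) _; first exact: powR_ge0.
  apply: ler_pM; rewrite ?addr_ge0 ?mulr_ge0 ?powR_ge0 ?frob_ge0 ?aM//.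
  exact: growth_flux.
- exact: (integrableZl mO M (in_Lp_powR_integrable Omega_open p1 LH)).
Qed.

(** The difference of the two fluxes is nonnegative almost everywhere by
    [coercive_flux] and integrates to zero, so it vanishes almost everywhere. *)
Lemma gradients_ae_eq (eps c1 c2 nu : R) (a : 'rV[R]_n -> R[i]) (L : R) F G :
  0 <= eps <= 1 -> structure_constants n N p c1 c2 -> 0 < nu ->
  class_E nu L c1 c2 Omega a -> Lp_mx p Omega F -> Lp_mx p Omega G ->
  \int[mu]_(x in OmegaL) flux eps a F (fun x => F x - G x) x =
  \int[mu]_(x in OmegaL) flux eps a G (fun x => F x - G x) x ->
  {ae mu, forall x, Omega x -> F x = G x}.
Proof.
move=> e01 hc nu0 [maR maI [M1 aM1] [M2 aM2] aE] LF LG eqI.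
pose D x := F x - G x.
have LD : Lp_mx p Omega D.
  move=> j k; have [[FR FI] [GR GI]] := (LF j k, LG j k); split.
  - have := in_LpB p1 FR GR.
    by congr in_Lp; apply/funext => x; rewrite !mxE ReB.
  - have := in_LpB p1 FI GI.
    by congr in_Lp; apply/funext => x; rewrite !mxE ImB.
have aM x : Omega x -> `|complex.Re (a x)| + `|complex.Im (a x)| <= M1 + M2.
  by move=> Ox; rewrite lerD ?aM1 ?aM2.
have iF := integrable_flux e01 maR maI aM LF LD.
have iG := integrable_flux e01 maR maI aM LG LD.
pose h x := flux eps a F D x - flux eps a G D x.
have hE x : h x = complex.Re
    (a x * inner (p_field p eps (F x) - p_field p eps (G x)) (F x - G x)).
  rewrite /h /flux -ReB; congr complex.Re.
  by rewrite innerBl /p_field !innerZl mulrBr !mulrA.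
have ih : mu.-integrable OmegaL (EFin \o h).
  exact: (integrableB mO iF iG).
have h0 : \int[mu]_(x in OmegaL) h x = 0.
  by rewrite /h RintegralB// eqI subrr.
have hcoer : {ae mu, forall x, Omega x ->
    nu * ((eps ^+ 2 + frob (F x) ^+ 2 + frob (G x) ^+ 2) `^ ((p - 2) / 2) *
      frob (F x - G x) ^+ 2) <= h x}.
  apply: filterS aE => x + Ox => /(_ Ox)[a1 a2 a3].
  rewrite hE; apply: coercive_flux hc _ (ltW a3) => //.
  by rewrite (le_trans (ltW nu0))// (le_trans (ltW a1))// gerBl.
have habs : (\int[mu]_(x in OmegaL) `|(h x)%:E| = 0)%E.
  transitivity (\int[mu]_(x in OmegaL) (h x)%:E)%E; last first.
    rewrite -(fineK (integrable_fin_num mO ih)).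
    by rewrite -[fine _]/(Rintegral _ _ _) h0.
  have [mh _] := integrableP _ _ _ ih.
  apply: ae_eq_integral.
  - exact: mO.
  - exact: (measurableT_comp (@abse_measurable R setT) mh).
  - exact: mh.
  apply: filterS hcoer => x + Ox => /(_ Ox) hx; rewrite gee0_abs// lee_fin.
  apply: le_trans hx; rewrite mulr_ge0 ?(ltW nu0)//.
  by rewrite mulr_ge0 ?powR_ge0 ?sqr_ge0.
have [mh _] := integrableP _ _ _ ih.
have [/(_ habs) hae _] := ae_eq_integral_abs mu mO mh.
apply: filterS2 hae hcoer => x hx cx Ox.
apply/eqP; rewrite -subr_eq0; apply/eqP.
apply: (weight_sqr_frob_eq0 (r := (p - 2) / 2) (eps := eps)).
have := cx Ox; have := hx Ox; rewrite /= => -[->].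
set q := _ * _ => q0; apply/eqP; rewrite eq_le.
rewrite -(pmulr_rle0 _ nu0) q0 /=.
by rewrite mulr_ge0 ?powR_ge0 ?sqr_ge0.
Qed.

End weak_gradients.

(** * Uniqueness *)

Theorem theorem5p2 (R : realType) (n N : nat) (hn : (2 <= n)%N) (hN : (1 <= N)%N)
    (Omega : set 'rV[R]_n) (Omega_open : open Omega)
    (Omega_bounded : bounded_set Omega)
    (p eps : R) (hp : 1 < p) (heps : 0 <= eps <= 1)
    (c1 c2 : R) (hc : structure_constants n N p c1 c2)
    (nu L : R) (hnu : 0 < nu) (hL : nu < L)
    (a : 'rV[R]_n -> R[i]) (ha : class_E nu L c1 c2 Omega a)
    (F : 'rV[R]_n -> 'M[R[i]]_(N, n)) (hF : Lp_mx (p / (p - 1)) Omega F)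
    (g : 'rV[R]_n -> 'cV[R[i]]_N) (hg : W1p p Omega g)
    (u1 u2 : 'rV[R]_n -> 'cV[R[i]]_N) :
  weak_solution p eps Omega a F u1 -> W01p p Omega (fun x => u1 x - g x) ->
  weak_solution p eps Omega a F u2 -> W01p p Omega (fun x => u2 x - g x) ->
  {ae lebesgue_rV R n, forall x, Omega x -> u1 x = u2 x}.
Proof.
case: n hn Omega Omega_open Omega_bounded hc a ha F hF g hg u1 u2 => [//|n] _.
move=> Omega Omega_open Omega_bounded hc a ha F hF g hg u1 u2.
move=> [W1 sol1] bd1 [W2 sol2] bd2.
have W0 := W01p_sub_boundary Omega_open Omega_bounded hp bd1 bd2.
have [Du1 wD1] := W1p_weak_gradient W1.
have [Du2 wD2] := W1p_weak_gradient W2.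
have wD := weak_gradientB Omega_open Omega_bounded hp W1 W2 wD1 wD2.
have grad_eq : {ae lebesgue_rV R n.+1, forall x, Omega x -> Du1 x = Du2 x}.
  apply: (gradients_ae_eq Omega_open Omega_bounded hp heps hc hnu ha
    (weak_gradient_Lp wD1) (weak_gradient_Lp wD2)).
  have /(congr1 (@complex.Re R)) /= e1 := sol1 _ wD1 _ W0 _ wD.
  have /(congr1 (@complex.Re R)) /= e2 := sol2 _ wD2 _ W0 _ wD.
  by rewrite /flux e1 e2.
have comp_eq (j : 'I_N) : {ae lebesgue_rV R n.+1, forall x, Omega x ->
    (u1 x - u2 x) j 0 = 0}.
  have [W0R W0I] := W0 j; have [wDR wDI] := wD j.
  have R0 := real_W01p_eq0 Omega_open Omega_bounded hp W0R wDR.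
  have I0 := real_W01p_eq0 Omega_open Omega_bounded hp W0I wDI.
  apply: filterS2 (R0 _) (I0 _).
  - move=> x rx ix Ox; apply/eqP; rewrite eq_complex.
    by rewrite rx//= ix//= eqxx.
  - by apply: filterS grad_eq => x /[apply] ->; rewrite subrr mxE.
  - by apply: filterS grad_eq => x /[apply] ->; rewrite subrr mxE.
apply: filterS (filter_forall _ comp_eq) => x ex Ox.
apply/eqP; rewrite -subr_eq0; apply/eqP/colP => j.
by rewrite ex// mxE.
Qed.
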